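(* If $a\in\mathcal{F}$, then $m(a)=2^{-d(a)-1}$ and $m(s(a))=m(a)/2$.
   Context: The fuse operation is the partial binary operation on real numbers $a\sim b=(a+b+1)/2$, applicable only when $|a-b|<1$. A fusible number is a real number obtainable from $0$ by finitely many (valid) applications of the fuse operation; i.e. the set $\mathcal{F}$ of fusible numbers is the smallest subset of $\mathbb{R}$ such that $0\in\mathcal{F}$ and, whenever $a,b\in\mathcal{F}$ and $|a-b|<1$, also $(a+b+1)/2\in\mathcal{F}$. The set $\mathcal{F}$ is well-ordered by the usual order of $\mathbb{R}$. For $a\in\mathbb{R}$ define $s(a)=\min\{b\in\mathcal{F}: b>a\}$ and $m(a)=s(a)-a$. An expression is a formal term built from the constant $0$ and the binary symbol $\sim$ (equivalently, a finite full binary tree with leaves labelled $0$). It is valid if, on evaluating it, every application of $\sim$ is to operands $a,b$ with $|a-b|<1$. A valid expression $\alpha$ is called a presentation of its value $v(\alpha)\in\mathbb{R}$ (so $v(0)=0$ and $v(\alpha\sim\beta)=(v(\alpha)+v(\beta)+1)/2$). The depth of an expression is defined by $d(0)=0$ and $d(\alpha\sim\beta)=\max\{d(\alpha),d(\beta)\}+1$. The depth $d(a)$ of a fusible number $a$ is the maximal depth among all presentations of $a$. *)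

(* Defs.v *)
From Stdlib Require Import Reals Lra Lia ZArith ClassicalEpsilon.
Open Scope R_scope.

Definition fuse (a b : R) : R := (a + b + 1) / 2.

Definition can_fuse (a b : R) : Prop := Rabs (a - b) < 1.

Inductive fusible : R -> Prop :=
| fusible_zero : fusible 0
| fusible_fuse : forall a b : R,
    fusible a -> fusible b -> can_fuse a b -> fusible (fuse a b).

Definition is_next_fusible (a b : R) : Prop :=
  (fusible b /\ b > a) /\ forall c : R, fusible c /\ c > a -> b <= c.

(* The choice is never a default value: see [next_fusible_spec]. *)
Definition next_fusible (a : R) : R := epsilon (inhabits 0) (is_next_fusible a).

Definition gap (a : R) : R := next_fusible a - a.

Inductive expr : Set :=
| EZero : expr
| EFuse : expr -> expr -> expr.

Fixpoint value (e : expr) : R :=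
  match e with
  | EZero => 0
  | EFuse e1 e2 => fuse (value e1) (value e2)
  end.

Fixpoint valid (e : expr) : Prop :=
  match e with
  | EZero => True
  | EFuse e1 e2 => valid e1 /\ valid e2 /\ can_fuse (value e1) (value e2)
  end.

Fixpoint expr_depth (e : expr) : nat :=
  match e with
  | EZero => 0%nat
  | EFuse e1 e2 => (Nat.max (expr_depth e1) (expr_depth e2) + 1)%nat
  end.

Definition presentation (e : expr) (a : R) : Prop := valid e /\ value e = a.

Definition is_fusible_depth (a : R) (n : nat) : Prop :=
  (exists e : expr, presentation e a /\ expr_depth e = n) /\
  forall e : expr, presentation e a -> (expr_depth e <= n)%nat.

(* For fusible [a] the choice is never a default value:
   see [fusible_depth_spec]. *)
Definition fusible_depth (a : R) : nat :=
  epsilon (inhabits 0%nat) (is_fusible_depth a).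

Lemma fusible_presentation (a : R) :
  fusible a <-> exists e : expr, presentation e a.
Proof.
split.
- induction 1 as [|a b _ [e [He Ea]] _ [f [Hf Eb]] Hab].
  + exists EZero; split; simpl; auto.
  + exists (EFuse e f); split; simpl; rewrite ?Ea, ?Eb; auto.
- intros [e [He <-]]; induction e as [|e IHe f IHf]; simpl in *.
  + constructor.
  + destruct He as [He [Hf H]]; constructor; auto.
Qed.

Lemma can_fuse_iff (a b : R) : can_fuse a b <-> a - b < 1 /\ b - a < 1.
Proof.
unfold can_fuse, Rabs; destruct (Rcase_abs (a - b)); split; intros; lra.
Qed.

Lemma fusible_ge0 (a : R) : fusible a -> 0 <= a.
Proof. induction 1; unfold fuse; lra. Qed.

Lemma fusible_split (a : R) : fusible a -> a > 0 ->
  exists b c, fusible b /\ fusible c /\ b <= c /\ c - b < 1 /\ b + c = 2 * a - 1.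
Proof.
intros [|b c Hb Hc H] Ha; [lra|].
apply can_fuse_iff in H; unfold fuse in *.
destruct (Rle_dec b c).
- exists b, c; repeat split; auto; lra.
- exists c, b; repeat split; auto; lra.
Qed.

Lemma fusible_unbounded (a : R) : exists b, fusible b /\ b > a.
Proof.
assert (H : forall n, fusible (INR n / 2)).
{ induction n as [|n IH].
  - simpl; replace (0 / 2) with 0 by lra; constructor.
  - rewrite S_INR; replace ((INR n + 1) / 2) with (fuse (INR n / 2) (INR n / 2))
      by (unfold fuse; lra).
    constructor; auto; apply can_fuse_iff; lra. }
destruct (INR_unbounded (2 * a)) as [n Hn].
exists (INR n / 2); split; auto; lra.
Qed.

Lemma inf_exists (P : R -> Prop) (lo : R) :
  (exists y, P y) -> (forall y, P y -> lo <= y) ->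
  exists x, (forall y, P y -> x <= y) /\
            (forall e, e > 0 -> exists y, P y /\ y < x + e).
Proof.
intros [y0 Hy0] Hlo.
destruct (completeness (fun z => P (- z))) as [l [Hub Hl]].
- exists (- lo); intros z Hz; apply Hlo in Hz; lra.
- exists (- y0); rewrite Ropp_involutive; exact Hy0.
- exists (- l); split.
  + intros y Hy; assert (- y <= l); [|lra].
    apply Hub; rewrite Ropp_involutive; exact Hy.
  + intros e He; apply NNPP; intros Hn.
    assert (l <= l - e); [|lra].
    apply Hl; intros z Hz.
    destruct (Rle_dec z (l - e)) as [|Hz']; auto.
    exfalso; apply Hn; exists (- z); split; auto; lra.
Qed.

Lemma cluster_point (Q : R -> R -> Prop) (lo hi : R) :
  (forall e e' c, 0 < e' <= e -> Q e' c -> Q e c) ->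
  (forall e, e > 0 -> exists c, Q e c) ->
  (forall e c, Q e c -> lo <= c <= hi) ->
  exists x, lo <= x <= hi /\
    forall d e, d > 0 -> e > 0 -> exists c, Q e c /\ x - d < c < x + d.
Proof.
intros Hmono Hex Hbd.
destruct (inf_exists (fun c0 => forall e, e > 0 -> exists c, Q e c /\ c <= c0) lo)
  as [x [Hx1 Hx2]].
- exists hi; intros e He; destruct (Hex e He) as [c Hc].
  exists c; split; auto; apply (Hbd e c Hc).
- intros y Hy; destruct (Hy 1 ltac:(lra)) as [c [Hc Hcy]].
  apply Hbd in Hc; lra.
- exists x; split; [split|].
  + destruct (Rle_dec lo x) as [|Hn]; auto; exfalso.
    destruct (Hx2 (lo - x) ltac:(lra)) as [y [Hy Hyx]].
    destruct (Hy 1 ltac:(lra)) as [c [Hc Hcy]].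
    apply Hbd in Hc; lra.
  + apply Hx1; intros e He; destruct (Hex e He) as [c Hc].
    exists c; split; auto; apply (Hbd e c Hc).
  + intros d e Hd He.
    assert (H : exists e1, e1 > 0 /\ forall c, Q e1 c -> x - d < c).
    { apply NNPP; intros Hn.
      assert (x <= x - d); [|lra].
      apply Hx1; intros e1 He1; apply NNPP; intros Hn'.
      apply Hn; exists e1; split; auto; intros c Hc.
      destruct (Rlt_dec (x - d) c) as [|Hc']; auto.
      exfalso; apply Hn'; exists c; split; auto; lra. }
    destruct H as [e1 [He1 H1]].
    destruct (Hx2 d Hd) as [y [Hy Hyx]].
    assert (Hm : 0 < Rmin e e1) by (apply Rmin_pos; lra).
    pose proof (Rmin_l e e1); pose proof (Rmin_r e e1).
    destruct (Hy _ Hm) as [c [Hc Hcy]].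
    exists c; split; [apply (Hmono e (Rmin e e1)); auto|].
    split; [apply H1, (Hmono e1 (Rmin e e1)); auto|lra].
Qed.

Lemma fusible_right_gap (y : R) :
  exists e, e > 0 /\ forall f, fusible f -> y < f -> f < y + e -> False.
Proof.
set (good := fun y => exists e, e > 0 /\
               forall f, fusible f -> y < f -> f < y + e -> False).
change (good y); apply NNPP; intros Hbad.
assert (Hneg : forall z, ~ good z -> 0 <= z).
{ intros z Hz; destruct (Rle_dec 0 z) as [|Hn]; auto; exfalso; apply Hz.
  exists (- z); split; [lra|]; intros f Hf; apply fusible_ge0 in Hf; lra. }
destruct (inf_exists (fun z => ~ good z) 0 (ex_intro _ y Hbad) Hneg)
  as [x [Hx1 Hx2]].
assert (Hlt : forall z, z < x -> good z).
{ intros z Hz; apply NNPP; intros Hn; apply Hx1 in Hn; lra. }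
assert (Hxbad : forall e, e > 0 -> exists f, fusible f /\ x < f < x + e).
{ intros e He; apply NNPP; intros Hn.
  destruct (Hx2 e He) as [z [Hz Hzx]]; apply Hz.
  exists (x + e - z); split; [lra|]; intros f Hf Hzf Hfe; apply Hn.
  exists f; split; auto; apply Hx1 in Hz; lra. }
assert (Hx0 : 0 <= x).
{ apply Hneg; intros [e [He H]]; destruct (Hxbad e He) as [f [Hf Hf']].
  apply (H f); tauto. }
destruct (Hlt (x - 1) ltac:(lra)) as [e1 [He1 H1]].
destruct (cluster_point (fun e c => x - 1/2 <= c <= x /\ fusible c /\
    exists b, fusible b /\ 2 * x - 1 < b + c < 2 * x - 1 + 2 * e)
    (x - 1/2) x) as [c0 [Hc0 Hcl]].
- intros e e' c He [Hc [Fc [b [Fb Hb]]]]; split; auto; split; auto.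
  exists b; split; auto; lra.
- intros e He.
  assert (Hm : Rmin e (e1 / 2) > 0) by (apply Rmin_pos; lra).
  pose proof (Rmin_l e (e1 / 2)); pose proof (Rmin_r e (e1 / 2)).
  destruct (Hxbad _ Hm) as [f [Ff Hf]].
  destruct (fusible_split f Ff ltac:(lra)) as [b [c [Fb [Fc [Hbc [Hcb E]]]]]].
  assert (c <= x).
  { destruct (Rle_dec c x) as [|Hn]; auto; exfalso.
    apply (H1 b Fb); lra. }
  exists c; split; [lra|]; split; auto; exists b; split; auto; lra.
- intros e c [Hc _]; exact Hc.
- assert (H2 : exists e2, e2 > 0 /\
            forall c, fusible c -> c <= x -> c < c0 + e2 -> c <= c0).
  { destruct (Rlt_dec c0 x) as [Hl|Hl].
    - destruct (Hlt c0 Hl) as [e2 [He2 H2]]; exists e2; split; auto.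
      intros c Fc _ Hc; destruct (Rle_dec c c0) as [|Hn]; auto; exfalso.
      apply (H2 c); auto; lra.
    - exists 1; split; [lra|]; intros; lra. }
  destruct H2 as [e2 [He2 H2]].
  destruct (Hlt (2 * x - 1 - c0) ltac:(lra)) as [e3 [He3 H3]].
  assert (Hm : Rmin e2 (e3 / 2) > 0) by (apply Rmin_pos; lra).
  pose proof (Rmin_l e2 (e3 / 2)); pose proof (Rmin_r e2 (e3 / 2)).
  destruct (Hcl _ (e3 / 4) Hm ltac:(lra)) as [c [[Hc [Fc [b [Fb Hb]]]] Hcc]].
  assert (c <= c0) by (apply H2; auto; lra).
  apply (H3 b Fb); lra.
Qed.

Lemma fusible_min (P : R -> Prop) :
  (forall f, P f -> fusible f) -> (exists f, P f) ->
  exists x, P x /\ forall f, P f -> x <= f.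
Proof.
intros HP Hex.
destruct (inf_exists P 0 Hex) as [x [Hx1 Hx2]].
{ intros f Hf; apply fusible_ge0; auto. }
exists x; split; auto.
destruct (fusible_right_gap x) as [e [He H]].
destruct (Hx2 e He) as [f [Hf Hfx]].
destruct (Rle_lt_or_eq_dec x f (Hx1 f Hf)) as [Hl| ->]; auto.
exfalso; apply (H f); auto.
Qed.

Lemma next_fusible_spec (a : R) : is_next_fusible a (next_fusible a).
Proof.
unfold next_fusible; apply epsilon_spec.
destruct (fusible_min (fun b => fusible b /\ b > a)) as [x Hx].
- tauto.
- apply fusible_unbounded.
- exists x; exact Hx.
Qed.

Lemma presentation_depth_bounded (a : R) :
  exists N, forall e, presentation e a -> (expr_depth e <= N)%nat.
Proof.
set (bounded := fun a =>
       exists N, forall e, presentation e a -> (expr_depth e <= N)%nat).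
change (bounded a); apply NNPP; intros Hbad.
assert (Hlarge : forall z, ~ bounded z ->
          forall N, exists e, presentation e z /\ (N < expr_depth e)%nat).
{ intros z Hz N; apply NNPP; intros Hn; apply Hz; exists N; intros e He.
  destruct (Nat.le_gt_cases (expr_depth e) N) as [|Hl]; auto.
  exfalso; apply Hn; eauto. }
destruct (fusible_min (fun z => ~ bounded z)) as [x [Hx Hmin]].
{ intros z Hz; apply fusible_presentation.
  destruct (Hlarge z Hz 0%nat) as [e [He _]]; eauto. }
{ eauto. }
assert (Hlt : forall z, z < x -> bounded z).
{ intros z Hz; apply NNPP; intros Hn; apply Hmin in Hn; lra. }
destruct (cluster_point (fun d c => exists e f, presentation (EFuse e f) x /\
    value f = c /\ / d < INR (expr_depth (EFuse e f))) 0 x) as [c0 [Hc0 Hcl]].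
- intros d d' c Hd [e [f [Hp [Hc He]]]]; exists e, f; split; auto; split; auto.
  apply Rle_lt_trans with (/ d'); auto; apply Rinv_le_contravar; lra.
- intros d Hd; destruct (INR_unbounded (/ d)) as [N HN].
  destruct (Hlarge x Hx N) as [e [He HeN]].
  destruct e as [|e f]; [simpl in HeN; lia|].
  exists (value f), e, f; split; auto; split; auto.
  apply lt_INR in HeN; lra.
- intros d c [e [f [[[He [Hf Hef]] E] [<- _]]]].
  simpl in E; unfold fuse in E; apply can_fuse_iff in Hef.
  assert (0 <= value f); [|lra].
  apply fusible_ge0, fusible_presentation; exists f; split; auto.
- destruct (fusible_right_gap c0) as [e1 [He1 H1]].
  destruct (fusible_right_gap (2 * x - 1 - c0)) as [e2 [He2 H2]].
  assert (Hm : Rmin e1 e2 > 0) by (apply Rmin_pos; lra).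
  pose proof (Rmin_l e1 e2); pose proof (Rmin_r e1 e2).
  assert (Hkey : forall d, d > 0 -> exists e f, valid e /\ valid f /\
     value f = c0 /\ value e = 2 * x - 1 - c0 /\ value e < x /\ value f < x /\
     / d < INR (expr_depth (EFuse e f))).
  { intros d Hd.
    destruct (Hcl _ d Hm Hd) as [c [[e [f [[[He [Hf Hef]] E] [Hc Hdep]]]] Hcc]].
    simpl in E; unfold fuse in E; apply can_fuse_iff in Hef.
    assert (Fe : fusible (value e)) by (apply fusible_presentation; exists e; split; auto).
    assert (Ff : fusible (value f)) by (apply fusible_presentation; exists f; split; auto).
    assert (~ c0 < value f) by (intros Hl; apply (H1 _ Ff); lra).
    assert (~ 2 * x - 1 - c0 < value e) by (intros Hl; apply (H2 _ Fe); lra).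
    exists e, f; repeat split; auto; lra. }
  destruct (Hkey 1 ltac:(lra)) as [e0 [f0 [_ [_ [Ef0 [Ee0 [Le0 [Lf0 _]]]]]]]].
  destruct (Hlt c0 ltac:(lra)) as [N1 HN1].
  destruct (Hlt (2 * x - 1 - c0) ltac:(lra)) as [N2 HN2].
  set (N := (Nat.max N1 N2 + 1)%nat).
  assert (HN : 0 < INR N) by (apply lt_0_INR; unfold N; lia).
  destruct (Hkey (/ INR N) ltac:(apply Rinv_0_lt_compat; lra))
    as [e [f [Ve [Vf [Ef [Ee [_ [_ Hdep]]]]]]]].
  rewrite Rinv_inv in Hdep; apply INR_lt in Hdep.
  specialize (HN1 f (conj Vf Ef)); specialize (HN2 e (conj Ve Ee)).
  unfold N in Hdep; cbn [expr_depth] in Hdep; lia.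
Qed.

Lemma fusible_depth_spec (a : R) :
  fusible a -> is_fusible_depth a (fusible_depth a).
Proof.
intros Ha; unfold fusible_depth; apply epsilon_spec.
apply fusible_presentation in Ha; destruct Ha as [e0 He0].
destruct (presentation_depth_bounded a) as [N HN]; revert HN.
induction N as [|N IH]; intros HN.
- exists 0%nat; split; auto; exists e0; split; auto.
  specialize (HN e0 He0); lia.
- destruct (classic (exists e, presentation e a /\ expr_depth e = S N)) as [H|H].
  + exists (S N); split; auto.
  + apply IH; intros e He; specialize (HN e He).
    assert (expr_depth e <> S N) by (intros E; apply H; eauto); lia.
Qed.

(* Main.v *)
Require Import Defs.
From Stdlib Require Import Reals ZArith.
From Stdlib Require Import Lra Lia Classical.
Open Scope R_scope.

(** The bound [gap a <= 2^(-d(a)-1)] holds because [b ~ c] can always be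
    increased to [s(b) ~ c].  For the converse take the least counterexample [a]
    and write [s(a) = b ~ c].  Since [F] is closed, [b] is [0] or a successor
    [s(g)], and minimality of [s(a)] gives [gap g >= 2 gap a], with equality only
    if [g ~ c = a]; likewise for [c].  Equality would give [a] a presentation as
    deep as wanted.  Otherwise [a], [b] and [c] are multiples of powers of two
    exceeding [2 gap a], because a fusible number of depth [n] is a multiple of
    [2^-n], and then so is [b + c + 1 - 2 a = 2 gap a], which is absurd.

    Since [s(a) = a + 2^(-d(a)-1)] has depth greater than [d(a)], the second claim
    is a lower bound on [gap (s a)]: a deepest presentation [b ~ c] of [s(a)], with
    [b] the deeper operand, has [2 gap (s a) = gap b], and [gap b = gap g / 2] is at
    least [gap a] by induction. *)

(** * Successors, gaps and powers of two *)

Lemma can_fuse_comm (a b : R) : can_fuse a b -> can_fuse b a.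
Proof. rewrite !can_fuse_iff; tauto. Qed.

Lemma fuse_comm (a b : R) : fuse a b = fuse b a.
Proof. unfold fuse; lra. Qed.

Lemma next_fusible_fusible (a : R) : fusible (next_fusible a).
Proof. destruct (next_fusible_spec a) as [[H _] _]; exact H. Qed.

Lemma next_fusible_gt (a : R) : a < next_fusible a.
Proof. destruct (next_fusible_spec a) as [[_ H] _]; lra. Qed.

Lemma next_fusible_le (a b : R) : fusible b -> a < b -> next_fusible a <= b.
Proof.
intros Fb Hb; destruct (next_fusible_spec a) as [_ H]; apply H; split; auto; lra.
Qed.

Lemma next_fusible_unique (a b : R) : is_next_fusible a b -> next_fusible a = b.
Proof.
intros [[Fb Hb] H]; apply Rle_antisym.
- apply next_fusible_le; auto; lra.
- apply H; split; [apply next_fusible_fusible|apply next_fusible_gt].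
Qed.

Lemma gap_pos (a : R) : 0 < gap a.
Proof. unfold gap; pose proof (next_fusible_gt a); lra. Qed.

Lemma fusible_half (a : R) : fusible a -> fusible (a + 1 / 2).
Proof.
intros Fa; replace (a + 1 / 2) with (fuse a a) by (unfold fuse; lra).
constructor; auto; apply can_fuse_iff; lra.
Qed.

Lemma fusible_succ (a : R) : fusible a -> fusible (a + 1).
Proof.
intros Fa; replace (a + 1) with (a + 1 / 2 + 1 / 2) by lra.
apply fusible_half, fusible_half, Fa.
Qed.

Lemma gap_le_half (a : R) : fusible a -> gap a <= 1 / 2.
Proof.
intros Fa; apply fusible_half in Fa; apply (next_fusible_le a) in Fa; [|lra].
unfold gap; lra.
Qed.

Lemma inv_pow2_pos (n : nat) : 0 < / 2 ^ n.
Proof. apply Rinv_0_lt_compat, pow_lt; lra. Qed.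

Lemma inv_pow2_S (n : nat) : / 2 ^ S n = / 2 ^ n / 2.
Proof. simpl; field; apply pow_nonzero; lra. Qed.

Lemma inv_pow2_le (m n : nat) : (m <= n)%nat -> / 2 ^ n <= / 2 ^ m.
Proof.
intros H; apply Rinv_le_contravar; [apply pow_lt; lra|].
apply Rle_pow; auto; lra.
Qed.

(** * Left limits, and closedness of the fusible numbers *)

Lemma fusible_below_succ (a : R) (n : nat) :
  fusible a -> fusible (a + 1 - / 2 ^ n).
Proof.
intros Fa; induction n as [|n IH].
- simpl; rewrite Rinv_1; replace (a + 1 - 1) with a by lra; auto.
- rewrite inv_pow2_S.
  replace (a + 1 - / 2 ^ n / 2) with (fuse a (a + 1 - / 2 ^ n)) by (unfold fuse; lra).
  constructor; auto; apply can_fuse_iff.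
  pose proof (inv_pow2_pos n); pose proof (inv_pow2_le 0 n ltac:(lia)) as H1.
  simpl in H1; rewrite Rinv_1 in H1; lra.
Qed.

(** The fusible numbers [a + 1 - / 2 ^ n] increase to [a + 1], so one of them lies strictly between
    [x] and [a + 1]. *)
Lemma next_fusible_lt_succ (a x : R) :
  fusible a -> x < a + 1 -> next_fusible x < a + 1.
Proof.
intros Fa Hx.
destruct (pow_lt_1_zero (/ 2) ltac:(rewrite Rabs_pos_eq; lra) (a + 1 - x) ltac:(lra))
  as [n Hn].
specialize (Hn n (le_n n)); rewrite pow_inv in Hn.
pose proof (inv_pow2_pos n); rewrite Rabs_pos_eq in Hn by lra.
pose proof (next_fusible_le x _ (fusible_below_succ a n Fa) ltac:(lra)); lra.
Qed.

(** At a least counterexample [z], write the approximating fusible numbers as [b ~ c]. The operands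
    cluster at some [c0] and at [2 * z - 1 - c0], and right gaps force them to stay at or below
    these limits. Minimality of [z] makes each limit below [z] fusible, and [z] is rebuilt from
    them. *)
Lemma fusible_left_closed (x : R) :
  (forall e, e > 0 -> exists f, fusible f /\ x - e < f <= x) -> fusible x.
Proof.
intros Hx; apply NNPP; intros Nx.
set (bad := fun z => ~ fusible z /\
              forall e, e > 0 -> exists f, fusible f /\ z - e < f <= z).
destruct (inf_exists bad 0) as [z [Hz1 Hz2]].
- exists x; split; auto.
- intros z [_ Hz]; destruct (Rle_dec 0 z) as [|Hn]; auto; exfalso.
  destruct (Hz 1 ltac:(lra)) as [f [Ff Hf]]; apply fusible_ge0 in Ff; lra.
(* The infimum is attained: a bad [y] just above [z] would put fusible numbers inside the right gap
   of [z]. *)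
- assert (Bz : bad z).
  { destruct (fusible_right_gap z) as [e [He H]].
    destruct (Hz2 e He) as [y [By Hy]].
    destruct (Rle_lt_or_eq_dec z y (Hz1 y By)) as [Hl| ->]; auto; exfalso.
    destruct (proj2 By (y - z) ltac:(lra)) as [f [Ff Hf]].
    apply (H f); auto; lra. }
  assert (Hlt : forall y, y < z ->
            (forall e, e > 0 -> exists f, fusible f /\ y - e < f <= y) -> fusible y).
  { intros y Hy Ly; apply NNPP; intros Ny.
    assert (z <= y) by (apply Hz1; split; auto); lra. }
  destruct Bz as [Nz Lz].
  assert (z > 0).
  { destruct (Lz 1 ltac:(lra)) as [f [Ff Hf]]; apply fusible_ge0 in Ff.
    destruct (Rle_lt_or_eq_dec 0 z ltac:(lra)) as [|E]; auto.
    exfalso; apply Nz; rewrite <- E; constructor. }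
  destruct (cluster_point (fun e c => exists b, fusible b /\ fusible c /\ b <= c /\
      c < b + 1 /\ 2 * z - 1 - 2 * e < b + c <= 2 * z - 1) 0 z) as [c0 [Hc0 Hcl]].
  + intros e e' c He [b [Fb [Fc [Hbc [Hcb Hs]]]]]; exists b; repeat split; auto; lra.
  + intros e He.
    assert (Hm : Rmin e z > 0) by (apply Rmin_pos; lra).
    pose proof (Rmin_l e z); pose proof (Rmin_r e z).
    destruct (Lz _ Hm) as [f [Ff Hf]].
    destruct (fusible_split f Ff ltac:(lra)) as [b [c [Fb [Fc [Hbc [Hcb E]]]]]].
    exists c, b; repeat split; auto; lra.
  + intros e c [b [Fb [Fc H']]]; apply fusible_ge0 in Fc; lra.
  + destruct (fusible_right_gap c0) as [e1 [He1 H1]].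
    destruct (fusible_right_gap (2 * z - 1 - c0)) as [e2 [He2 H2]].
    assert (Hkey : forall e, e > 0 -> exists b c, fusible b /\ fusible c /\
       b <= c /\ c < b + 1 /\
       c0 - e < c <= c0 /\ 2 * z - 1 - c0 - e < b <= 2 * z - 1 - c0).
    { intros e He.
      assert (Hm : Rmin (Rmin e1 e2) (e / 2) > 0)
        by (repeat apply Rmin_pos; lra).
      pose proof (Rmin_l (Rmin e1 e2) (e / 2)); pose proof (Rmin_r (Rmin e1 e2) (e / 2)).
      pose proof (Rmin_l e1 e2); pose proof (Rmin_r e1 e2).
      destruct (Hcl _ (e / 4) Hm ltac:(lra)) as [c [[b [Fb [Fc Hbc]]] Hc]].
      assert (~ c0 < c) by (intros Hl; apply (H1 c Fc); lra).
      assert (~ 2 * z - 1 - c0 < b) by (intros Hl; apply (H2 b Fb); lra).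
      exists b, c; repeat split; auto; lra. }
    assert (c0 <= 2 * z - 1 - c0 + 1) by lra.
    assert (2 * z - 1 - c0 <= c0).
    { apply Rnot_lt_le; intros Hl.
      destruct (Hkey ((2 * z - 1 - c0 - c0)) ltac:(lra)) as [b [c Hbc]]; lra. }
    assert (Fb0 : fusible (2 * z - 1 - c0)).
    { apply Hlt; [lra|]; intros e He.
      destruct (Hkey e He) as [b [c Hbc]]; exists b; tauto. }
    apply Nz; destruct (Rle_lt_or_eq_dec c0 z ltac:(lra)) as [Hl|E].
    * assert (Fc0 : fusible c0).
      { apply Hlt; [lra|]; intros e He.
        destruct (Hkey e He) as [b [c Hbc]]; exists c; tauto. }
      replace z with (fuse (2 * z - 1 - c0) c0) by (unfold fuse; lra).
      constructor; auto; apply can_fuse_iff; lra.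
    (* The two limits now differ by exactly 1 and cannot be fused, but [z] is the smaller one plus
       1. *)
    * replace z with (2 * z - 1 - c0 + 1) by lra; apply fusible_succ, Fb0.
Qed.

(** Let [x] be the supremum of the fusible numbers below [b]. If [x < b], closedness makes [x]
    fusible, and [b] is its successor; if [x = b], then [b] is a left limit. *)
Lemma fusible_succ_or_limit (b : R) :
  fusible b -> b <> 0 ->
  (exists g, fusible g /\ next_fusible g = b) \/
  (forall e, e > 0 -> exists f, fusible f /\ b - e < f < b).
Proof.
intros Fb Nb; pose proof (fusible_ge0 b Fb).
destruct (completeness (fun f => fusible f /\ f < b)) as [x [Hub Hl]].
- exists b; intros f [_ Hf]; lra.
- exists 0; split; [constructor|lra].
- assert (Happ : forall e, e > 0 -> exists f, fusible f /\ f < b /\ x - e < f <= x).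
  { intros e He; apply NNPP; intros Hn; assert (x <= x - e); [|lra].
    apply Hl; intros f [Ff Hf]; apply Rnot_lt_le; intros Hfx; apply Hn.
    exists f; repeat split; auto; apply Hub; split; auto. }
  assert (x <= b) by (apply Hl; intros f [_ Hf]; lra).
  destruct (Rle_lt_or_eq_dec x b ltac:(lra)) as [Hxb| ->].
  + left; exists x; split.
    * apply fusible_left_closed; intros e He.
      destruct (Happ e He) as [f Hf]; exists f; tauto.
    * apply next_fusible_unique; repeat split; auto.
      intros c [Fc Hc]; apply Rnot_lt_le; intros Hcb.
      assert (c <= x) by (apply Hub; split; auto); lra.
  + right; intros e He; destruct (Happ e He) as [f Hf]; exists f; repeat split; try tauto.
Qed.

(** * Operands of a decomposition of [s(a)] *)

Lemma fuse_next_step (a b c f : R) :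
  fusible c -> can_fuse b c -> fuse b c = next_fusible a ->
  fusible f -> f < b -> c < f + 1 -> 2 * gap a <= b - f.
Proof.
intros Fc Hbc E Ff Hf Hc; apply can_fuse_iff in Hbc.
assert (Ffc : fusible (fuse f c)) by (constructor; auto; apply can_fuse_iff; lra).
(* [f ~ c] lies below [s(a)], so it is at most [a]; the drop from [b] to [f] is twice the drop of
   the fuse. *)
assert (~ a < fuse f c).
{ intros H; apply next_fusible_le in H; auto; unfold fuse in *; lra. }
unfold gap; unfold fuse in *; lra.
Qed.

(** If [b] were a left limit, lowering it slightly would put a fusible number strictly between [a]
    and [s(a)]. *)
Lemma fuse_next_is_succ (a b c : R) :
  fusible b -> fusible c -> can_fuse b c -> fuse b c = next_fusible a -> b <> 0 ->
  exists g, fusible g /\ next_fusible g = b.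
Proof.
intros Fb Fc Hbc E Nb.
destruct (fusible_succ_or_limit b Fb Nb) as [|Hlim]; auto; exfalso.
pose proof (proj1 (can_fuse_iff b c) Hbc); pose proof (gap_pos a).
assert (Hm : Rmin (b + 1 - c) (gap a) > 0) by (apply Rmin_pos; lra).
pose proof (Rmin_l (b + 1 - c) (gap a)); pose proof (Rmin_r (b + 1 - c) (gap a)).
destruct (Hlim _ Hm) as [f [Ff Hf]].
pose proof (fuse_next_step a b c f Fc Hbc E Ff ltac:(lra) ltac:(lra)); lra.
Qed.

Lemma fuse_next_pred (a b c : R) :
  fusible b -> fusible c -> can_fuse b c -> fuse b c = next_fusible a -> b <> 0 ->
  exists g, fusible g /\ next_fusible g = b /\
    (2 * gap a < gap g \/ 2 * gap a = gap g /\ can_fuse g c /\ fuse g c = a).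
Proof.
intros Fb Fc Hbc E Nb.
destruct (fuse_next_is_succ a b c Fb Fc Hbc E Nb) as [g [Fg Eg]].
exists g; split; auto; split; auto.
pose proof (proj1 (can_fuse_iff b c) Hbc) as Hd.
pose proof (next_fusible_gt g); pose proof (gap_le_half g Fg).
assert (Gg : gap g = b - g) by (unfold gap; lra).
destruct (Rlt_le_dec c (g + 1)) as [Hc|Hc].
- pose proof (fuse_next_step a b c g Fc Hbc E Fg ltac:(lra) Hc).
  destruct (Rle_lt_or_eq_dec (2 * gap a) (gap g) ltac:(lra)) as [|Eq]; auto.
  right; split; auto; split; [apply can_fuse_iff; lra|].
  unfold gap in *; unfold fuse in *; lra.
(* [g ~ c] is not allowed here; but [c = s(p)] with [g + 1 <= p], as [g + 1] is a
   limit, so [gap p < gap g] because [c < b + 1]. *)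
- left; apply can_fuse_comm in Hbc; rewrite fuse_comm in E.
  pose proof (fusible_ge0 g Fg).
  destruct (fuse_next_is_succ a c b Fc Fb Hbc E ltac:(lra)) as [p [Fp Ep]].
  pose proof (next_fusible_gt p).
  assert (g + 1 <= p).
  { apply Rnot_lt_le; intros Hp; apply (next_fusible_lt_succ g p Fg) in Hp; lra. }
  pose proof (fuse_next_step a c b p Fb Hbc E Fp ltac:(lra) ltac:(lra)); lra.
Qed.

(** * Upper bound on the gap *)

Lemma gap_fuse_le (b c : R) :
  fusible b -> fusible c -> can_fuse b c -> gap (fuse b c) <= gap b / 2.
Proof.
intros Fb Fc Hbc; apply can_fuse_iff in Hbc.
(* As [c + 1] is a left limit, [b < c + 1] gives [s(b) < c + 1], so [s(b) ~ c] is still allowed. *)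
pose proof (next_fusible_lt_succ c b Fc ltac:(lra)).
pose proof (next_fusible_gt b).
assert (F : fusible (fuse (next_fusible b) c)).
{ constructor; auto; [apply next_fusible_fusible|apply can_fuse_iff; lra]. }
apply (next_fusible_le (fuse b c)) in F; unfold gap, fuse in *; lra.
Qed.

Lemma valid_fusible (e : expr) : valid e -> fusible (value e).
Proof. intros V; apply fusible_presentation; exists e; split; auto. Qed.

Lemma gap_value_le (e : expr) :
  valid e -> gap (value e) <= / 2 ^ S (expr_depth e).
Proof.
induction e as [|e IHe f IHf]; intros V.
- cbn; rewrite Rmult_1_r; pose proof (gap_le_half 0 fusible_zero); lra.
- destruct V as [Ve [Vf H]]; cbn [value expr_depth].
  rewrite inv_pow2_S, Nat.add_1_r.
  pose proof (valid_fusible e Ve) as Fe; pose proof (valid_fusible f Vf) as Ff.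
  destruct (Nat.max_spec (expr_depth e) (expr_depth f)) as [[_ ->]|[_ ->]].
  + rewrite fuse_comm; specialize (IHf Vf).
    pose proof (gap_fuse_le _ _ Ff Fe (can_fuse_comm _ _ H)); lra.
  + specialize (IHe Ve); pose proof (gap_fuse_le _ _ Fe Ff H); lra.
Qed.

Lemma gap_le_depth (a : R) : fusible a -> gap a <= / 2 ^ S (fusible_depth a).
Proof.
intros Fa; destruct (fusible_depth_spec a Fa) as [[e [[V <-] <-]] _].
apply gap_value_le, V.
Qed.

(** * Dyadic arithmetic *)

Lemma value_dyadic (e : expr) (n : nat) :
  (expr_depth e <= n)%nat -> exists z : Z, value e = IZR z * / 2 ^ n.
Proof.
(* [n] is kept general so that operands of unequal depth share the denominator [2 ^ n]. *)
revert n; induction e as [|e IHe f IHf]; intros n Hn; cbn in *.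
- exists 0%Z; lra.
- destruct n as [|n]; [lia|].
  destruct (IHe n ltac:(lia)) as [u ->]; destruct (IHf n ltac:(lia)) as [v ->].
  exists (u + v + 2 ^ Z.of_nat n)%Z.
  rewrite !plus_IZR, <- pow_IZR, inv_pow2_S; unfold fuse.
  field; apply pow_nonzero; lra.
Qed.

Lemma fusible_dyadic (a : R) :
  fusible a -> exists z : Z, a = IZR z * / 2 ^ fusible_depth a.
Proof.
intros Fa; destruct (fusible_depth_spec a Fa) as [[e [[V E] D]] _].
destruct (value_dyadic e (fusible_depth a)) as [z Hz]; [lia|].
exists z; congruence.
Qed.

(** The exponent is left free: of two dyadic grids with step above [e], the finer contains the
    other, which gives closure under sums and differences. *)
Definition coarse (e x : R) : Prop :=
  exists (n : nat) (z : Z), e < / 2 ^ n /\ x = IZR z * / 2 ^ n.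

Lemma coarse_refine (m n : nat) (z : Z) :
  (m <= n)%nat -> exists w : Z, IZR z * / 2 ^ m = IZR w * / 2 ^ n.
Proof.
intros H; exists (z * 2 ^ Z.of_nat (n - m))%Z.
replace n with (m + (n - m))%nat at 2 by lia.
rewrite mult_IZR, <- pow_IZR, pow_add.
field; split; apply pow_nonzero; lra.
Qed.

Lemma coarse_sub (e x y : R) : coarse e x -> coarse e y -> coarse e (x - y).
Proof.
intros [m [u [Hm ->]]] [n [v [Hn ->]]].
destruct (Nat.le_ge_cases m n) as [H|H].
- destruct (coarse_refine m n u H) as [w ->].
  exists n, (w - v)%Z; rewrite minus_IZR; split; auto; lra.
- destruct (coarse_refine n m v H) as [w ->].
  exists m, (u - w)%Z; rewrite minus_IZR; split; auto; lra.
Qed.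

Lemma coarse_add (e x y : R) : coarse e x -> coarse e y -> coarse e (x + y).
Proof.
intros Hx [n [v Hv]]; replace (x + y) with (x - - y) by lra.
apply coarse_sub; auto; exists n, (- v)%Z; rewrite opp_IZR; split; lra.
Qed.

Lemma coarse_self (e : R) : 0 < e -> ~ coarse e e.
Proof.
intros He [n [z [Hn E]]]; pose proof (inv_pow2_pos n).
assert (0 < z)%Z by (apply lt_IZR, (Rmult_lt_reg_r (/ 2 ^ n)); lra).
assert (1 <= IZR z) by (apply IZR_le; lia); nra.
Qed.

(** * The first claim: the gap in terms of the depth *)

Lemma fusible_ge_half (a : R) : fusible a -> a <> 0 -> 1 / 2 <= a.
Proof.
intros [|b c Fb Fc _] H; [lra|].
apply fusible_ge0 in Fb, Fc; unfold fuse; lra.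
Qed.

Lemma gap_zero : gap 0 = 1 / 2.
Proof.
apply Rle_antisym; [apply gap_le_half; constructor|].
pose proof (next_fusible_gt 0).
pose proof (fusible_ge_half _ (next_fusible_fusible 0) ltac:(lra)).
unfold gap; lra.
Qed.

Lemma fuse_next_le (a b c : R) :
  fusible b -> can_fuse b c -> fuse b c = next_fusible a -> b <= a.
Proof.
intros Fb Hbc E; apply can_fuse_iff in Hbc; apply Rnot_lt_le; intros Hb.
apply (next_fusible_le a b Fb) in Hb; unfold fuse in *; lra.
Qed.

Lemma fuse_depth_lt (b c : R) :
  fusible b -> fusible c -> can_fuse b c ->
  (fusible_depth b < fusible_depth (fuse b c))%nat.
Proof.
intros Fb Fc H.
destruct (fusible_depth_spec b Fb) as [[e [[Ve Ee] <-]] _].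
destruct (proj1 (fusible_presentation c) Fc) as [f [Vf Ef]].
destruct (fusible_depth_spec _ (fusible_fuse b c Fb Fc H)) as [_ Hmax].
specialize (Hmax (EFuse e f)).
enough (expr_depth (EFuse e f) <= fusible_depth (fuse b c))%nat by (cbn in *; lia).
apply Hmax; split; cbn; rewrite Ee, Ef; auto.
Qed.

Lemma fuse_next_coarse (a b c : R) :
  (forall g, fusible g -> g < a -> gap g = / 2 ^ S (fusible_depth g)) ->
  gap a < / 2 ^ S (fusible_depth a) ->
  fusible b -> fusible c -> can_fuse b c -> fuse b c = next_fusible a ->
  coarse (2 * gap a) b.
Proof.
intros IH Hlt Fb Fc Hbc E; rewrite inv_pow2_S in Hlt.
destruct (Req_dec b 0) as [->|Nb].
- exists 0%nat, 0%Z; split; [|lra].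
  pose proof (inv_pow2_le 0 (fusible_depth a) ltac:(lia)); simpl in *; lra.
- destruct (fuse_next_pred a b c Fb Fc Hbc E Nb) as [g [Fg [Eg Hg]]].
  pose proof (fuse_next_le a b c Fb Hbc E); pose proof (next_fusible_gt g).
  specialize (IH g Fg ltac:(lra)).
  destruct Hg as [Hg|[Hg [Hgc Ea]]].
  + destruct (fusible_dyadic g Fg) as [z Hz].
    exists (S (fusible_depth g)), (2 * z + 1)%Z; split; [lra|].
    replace b with (g + gap g) by (unfold gap; lra).
    rewrite IH, plus_IZR, mult_IZR, inv_pow2_S; rewrite Hz at 1; lra.
  (* Since [g ~ c = a], the depth of [g] is below that of [a], so [gap g] is at least
     [/ 2 ^ fusible_depth a], which exceeds [2 * gap a]. *)
  + exfalso; pose proof (fuse_depth_lt g c Fg Fc Hgc) as Hd; rewrite Ea in Hd.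
    apply inv_pow2_le in Hd; lra.
Qed.

Lemma fusible_ind_lt (P : R -> Prop) :
  (forall a, fusible a -> (forall g, fusible g -> g < a -> P g) -> P a) ->
  forall a, fusible a -> P a.
Proof.
intros H a Fa; apply NNPP; intros Na.
destruct (fusible_min (fun x => fusible x /\ ~ P x)) as [x [[Fx Nx] Hmin]].
- tauto.
- eauto.
- apply Nx, H; auto; intros g Fg Hg; apply NNPP; intros Ng.
  specialize (Hmin g (conj Fg Ng)); lra.
Qed.

Lemma next_fusible_fuse (a : R) : 0 <= a ->
  exists b c, fusible b /\ fusible c /\ can_fuse b c /\ fuse b c = next_fusible a.
Proof.
intros Ha; pose proof (next_fusible_gt a).
destruct (next_fusible_fusible a) as [|b c Fb Fc H']; [lra|].
exists b, c; auto.
Qed.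

Lemma gap_depth (a : R) : fusible a -> gap a = / 2 ^ S (fusible_depth a).
Proof.
revert a; apply fusible_ind_lt; intros a Fa IH.
destruct (Rle_lt_or_eq_dec _ _ (gap_le_depth a Fa)) as [Hlt|]; auto; exfalso.
destruct (next_fusible_fuse a (fusible_ge0 a Fa)) as [b [c [Fb [Fc [Hbc E]]]]].
pose proof (fuse_next_coarse a b c IH Hlt Fb Fc Hbc E) as Cb.
pose proof (fuse_next_coarse a c b IH Hlt Fc Fb (can_fuse_comm _ _ Hbc)
  ltac:(rewrite fuse_comm; exact E)) as Cc.
pose proof Hlt as Hlt'; rewrite inv_pow2_S in Hlt'.
assert (Ca : coarse (2 * gap a) a).
{ destruct (fusible_dyadic a Fa) as [z Hz].
  exists (fusible_depth a), z; split; auto; lra. }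
assert (C1 : coarse (2 * gap a) 1).
{ exists 0%nat, 1%Z; pose proof (inv_pow2_le 0 (fusible_depth a) ltac:(lia)).
  simpl in *; split; lra. }
pose proof (gap_pos a); apply (coarse_self (2 * gap a)); [lra|].
replace (2 * gap a) with (b + c + 1 - (a + a)) at 2
  by (unfold gap; rewrite <- E; unfold fuse; lra).
apply coarse_sub; repeat apply coarse_add; auto.
Qed.

(** * The second claim: the gap halves at the successor *)

Lemma fuse_next_gap_ge (a b c : R) :
  (forall g, fusible g -> g < a -> gap (next_fusible g) = gap g / 2) ->
  fusible a ->
  fusible b -> fusible c -> can_fuse b c -> fuse b c = next_fusible a ->
  gap a <= gap b.
Proof.
intros IH Fa Fb Fc Hbc E.
destruct (Req_dec b 0) as [->|Nb].
(* The gap at 0 is the largest gap of any fusible number. *)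
- rewrite gap_zero; apply gap_le_half, Fa.
- destruct (fuse_next_pred a b c Fb Fc Hbc E Nb) as [g [Fg [Eg Hg]]].
  pose proof (fuse_next_le a b c Fb Hbc E); pose proof (next_fusible_gt g).
  specialize (IH g Fg ltac:(lra)); rewrite Eg in IH; lra.
Qed.

(** Otherwise [a] and [s(a)] would both be multiples of [/ 2 ^ fusible_depth a], while their
    difference is only half of it. *)
Lemma next_fusible_depth_lt (a : R) :
  fusible a -> (fusible_depth a < fusible_depth (next_fusible a))%nat.
Proof.
intros Fa; apply Nat.nle_gt; intros Hd.
pose proof (gap_depth a Fa) as G; rewrite inv_pow2_S in G.
apply inv_pow2_le in Hd; pose proof (inv_pow2_pos (fusible_depth a)).
apply (coarse_self (gap a)); [lra|]; unfold gap at 2; apply coarse_sub.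
- destruct (fusible_dyadic _ (next_fusible_fusible a)) as [z Hz].
  exists (fusible_depth (next_fusible a)), z; split; auto; lra.
- destruct (fusible_dyadic a Fa) as [z Hz].
  exists (fusible_depth a), z; split; auto; lra.
Qed.

Lemma gap_next (a : R) : fusible a -> gap (next_fusible a) = gap a / 2.
Proof.
revert a; apply fusible_ind_lt; intros a Fa IH.
pose proof (next_fusible_fusible a) as Fs.
apply Rle_antisym.
- rewrite !gap_depth by auto; rewrite <- inv_pow2_S; apply inv_pow2_le.
  apply next_fusible_depth_lt in Fa; lia.
- rewrite (gap_depth _ Fs), inv_pow2_S.
  enough (gap a <= / 2 ^ fusible_depth (next_fusible a)) by lra.
  pose proof (fusible_ge0 a Fa); pose proof (next_fusible_gt a).
  destruct (fusible_depth_spec _ Fs) as [[e [[V E] D]] _].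
  destruct e as [|e f]; [simpl in E; lra|].
  destruct V as [Ve [Vf Hef]]; cbn [value expr_depth] in *.
  pose proof (valid_fusible e Ve) as Fe; pose proof (valid_fusible f Vf) as Ff.
  rewrite <- D, Nat.add_1_r.
  (* The deeper operand has depth one less than that of [s(a)], so [gap_value_le] bounds its gap,
     and hence [gap a], by the required power. *)
  destruct (Nat.max_spec (expr_depth e) (expr_depth f)) as [[_ ->]|[_ ->]].
  + apply can_fuse_comm in Hef; rewrite fuse_comm in E.
    pose proof (fuse_next_gap_ge a _ _ IH Fa Ff Fe Hef E).
    pose proof (gap_value_le f Vf); lra.
  + pose proof (fuse_next_gap_ge a _ _ IH Fa Fe Ff Hef E).
    pose proof (gap_value_le e Ve); lra.
Qed.

Theorem theorem7 :
  forall a : R, fusible a ->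
    gap a = powerRZ 2 (- Z.of_nat (fusible_depth a) - 1) /\
    gap (next_fusible a) = gap a / 2.
Proof.
intros a Fa; split; [|apply gap_next, Fa].
rewrite gap_depth by auto.
replace (- Z.of_nat (fusible_depth a) - 1)%Z
  with (- Z.of_nat (S (fusible_depth a)))%Z by lia.
rewrite powerRZ_neg', <- pow_powerRZ; reflexivity.
Qed.
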